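(* Let $P$ be a finite poset with $n$ elements. Then $$L_P=\sum_{\alpha\models n}\ \sum_{\omega\in\Sigma_P(\alpha)}M_{\alpha}=\sum_{\alpha\models n}|\Sigma_P(\alpha)|\,M_\alpha .$$
   Context: $\mathbf{k}$ is a field of characteristic $0$. $\alpha\models n$ means $\alpha=(\alpha_1,\dots,\alpha_k)$ is a composition of $n$, and $M_\alpha=\sum_{i_1<\cdots<i_k}x_{i_1}^{\alpha_1}\cdots x_{i_k}^{\alpha_k}$ is the monomial quasisymmetric function. For a finite poset $P$ with $n$ elements, a $P$-listing is a list $\omega=(\omega_1,\dots,\omega_n)$ of all elements of $P$ without repetition; $\Sigma_P$ is the set of $P$-listings. A linear extension of $P$ is a $P$-listing for which there are no $i<j$ with $\omega_j\leq_P\omega_i$. $\zeta(P)$ is the number of linear extensions of $P$. A composition $\alpha=(\alpha_1,\dots,\alpha_k)\models n$ is compatible with $\omega\in\Sigma_P$ if each of the consecutive segments $(\omega_1,\dots,\omega_{\alpha_1}),\dots,(\omega_{\alpha_1+\cdots+\alpha_{k-1}+1},\dots,\omega_n)$ is a linear extension of the induced subposet on its elements. $\Sigma_P(\alpha)$ is the set of all $\omega\in\Sigma_P$ with which $\alpha$ is compatible. Definition of $L_P$: let $\mathcal{P}=\bigoplus_{n\ge0}\mathcal{P}_n$, where $\mathcal{P}_n$ is the $\mathbf{k}$-span of all partial orders on $[n]$, with product the ordinal sum $PQ$ (all elements of $P$ below all elements of the shifted $Q$) and coproduct $\Delta(P)=\sum_{S\subseteq[n]}\mathrm{st}(P|_S)\otimes\mathrm{st}(P|_{[n]\setminus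 S})$, where $\mathrm{st}$ is order-preserving relabeling of a finite set $A\subseteq\mathbb N$ by $\{1,\dots,|A|\}$. This is a graded connected Hopf algebra and $\zeta$, extended linearly, is a character (algebra homomorphism $\mathcal{P}\to\mathbf{k}$). The linear function of $P$ is $L_P=\Psi(P)$, where $\Psi:(\mathcal{P},\zeta)\to(QSym,\zeta_Q)$ is the canonical morphism of combinatorial Hopf algebras, given on $h\in\mathcal{P}_n$ by $\Psi(h)=\sum_{\alpha\models n}\zeta_\alpha(h)M_\alpha$, where for $\alpha=(\alpha_1,\dots,\alpha_k)$, $\zeta_\alpha$ is the composite $\mathcal{P}\xrightarrow{\Delta^{(k-1)}}\mathcal{P}^{\otimes k}\xrightarrow{proj}\mathcal{P}_{\alpha_1}\otimes\cdots\otimes\mathcal{P}_{\alpha_k}\xrightarrow{\zeta^{\otimes k}}\mathbf{k}$. (A poset on any $n$-element set is handled by relabeling it with $[n]$; $L_P$ depends only on the isomorphism class.) *)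

(* Defs.v *)
From HB Require Import structures.
From mathcomp Require Import all_boot all_order all_algebra.
From mathcomp Require Import finmap monalg.
From mathcomp Require Import boolp classical_sets functions fsbigop.

Set Implicit Arguments.
Unset Strict Implicit.
Unset Printing Implicit Defensive.

Import Order.TTheory GRing.Theory.
Local Open Scope ring_scope.

Section Composition.
Variable n : nat.

Definition is_composition (s : seq nat) : bool :=
  all (fun a => 0 < a)%N s && (sumn s == n).

Record composition := Composition {
  parts :> seq nat;
  _ : is_composition parts }.

HB.instance Definition _ := [isSub for parts].
HB.instance Definition _ := [Countable of composition by <:].

(* A composition of n has at most n parts, each at most n. *)
Lemma composition_bounds (s : seq nat) : is_composition s ->
  (size s <= n)%N /\ all (fun a => a < n.+1)%N s.
Proof.
case/andP=> + /eqP <-; elim: s => //= a s IHs /andP[a_gt0 /IHs[les alls]].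
split; first by rewrite -add1n leq_add.
rewrite ltnS leq_addr /=; apply: sub_all alls => b ltb.
by apply: leq_trans ltb _; rewrite ltnS leq_addl.
Qed.

Definition composition_code (a : composition) : n.-bseq 'I_n.+1 :=
  insub_bseq n [seq inord i | i <- a].

Definition composition_decode (b : n.-bseq 'I_n.+1) : option composition :=
  insub [seq val i | i <- b].

Lemma composition_codeK : pcancel composition_code composition_decode.
Proof.
move=> [s cs]; have [les alls] := composition_bounds cs.
rewrite /composition_decode /composition_code insubdK; last first.
  by rewrite unfold_in size_map.
suff -> : [seq val i | i <- [seq (inord i : 'I_n.+1) | i <- s]] = s.
  exact: (valK (Composition cs)).
rewrite -map_comp -[RHS]map_id; apply/eq_in_map => i /(allP alls) lti /=.
by rewrite inordK.
Qed.

HB.instance Definition _ : isFinite composition := PCanIsFinite composition_codeK.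

End Composition.

Section Porder.
Variable T : finType.

Definition is_porder (r : {set T * T}) : bool :=
  [&& [forall x, (x, x) \in r],
      [forall x, forall y, ((x, y) \in r) && ((y, x) \in r) ==> (x == y)]
    & [forall x, forall y, forall z,
         ((x, y) \in r) && ((y, z) \in r) ==> ((x, z) \in r)]].

Record porder := Porder { graph : {set T * T}; _ : is_porder graph }.

HB.instance Definition _ := [isSub for graph].
HB.instance Definition _ := [Finite of porder by <:].

Definition porder_rel (r : porder) : rel T := fun x y => (x, y) \in graph r.

Lemma is_porderP (r : rel T) :
  reflect [/\ reflexive r, antisymmetric r & transitive r]
          (is_porder [set xy | r xy.1 xy.2]).
Proof.
apply: (iffP and3P) => [[/forallP rR /forallP rA /forallP rT]|[rR rA rT]].
  split=> [x|x y|y x z].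
  - by have := rR x; rewrite inE.
  - by have /forallP/(_ y)/implyP := rA x; rewrite !inE => rA' /rA'/eqP.
  - have /forallP/(_ y)/forallP/(_ z)/implyP := rT x.
    by rewrite !inE /= => rT' rxy ryz; apply: rT'; rewrite rxy.
split; first by apply/forallP=> x; rewrite inE; apply: rR.
  apply/forallP=> x; apply/forallP=> y; apply/implyP; rewrite !inE /= => rxy.
  by rewrite (rA x y rxy).
apply/forallP=> x; apply/forallP=> y; apply/forallP=> z; apply/implyP.
by rewrite !inE => /andP[/= rxy ryz]; apply: rT rxy ryz.
Qed.

Lemma porder_relP (r : porder) :
  [/\ reflexive (porder_rel r), antisymmetric (porder_rel r)
    & transitive (porder_rel r)].
Proof.
apply/is_porderP; case: r => r r_po; rewrite /porder_rel /=.
by congr is_porder: r_po; apply/setP=> -[x y]; rewrite inE.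
Qed.

End Porder.

Coercion porder_rel : porder >-> rel.

Lemma order_porder_subproof d (P : finPOrderType d) :
  is_porder [set xy : P * P | (xy.1 <= xy.2)%O].
Proof.
by apply/is_porderP; split; [exact: lexx | exact: le_anti | exact: le_trans].
Qed.

Definition order_porder d (P : finPOrderType d) : porder P :=
  Porder (order_porder_subproof P).

Section Standardization.
Variables (T : finType) (r : porder T) (A : {pred T}).

Lemma st_subproof :
  is_porder [set ij : 'I_#|A| * 'I_#|A| | r (enum_val ij.1) (enum_val ij.2)].
Proof.
have [rR rA rT] := porder_relP r.
apply/(is_porderP (fun i j => r (enum_val i) (enum_val j))); split.
- by move=> i; apply: rR.
- by move=> i j /rA; apply: enum_val_inj.
- by move=> j i k; apply: rT.
Qed.

(* [enum_val] lists the elements of [A] in the order of [enum T]; when [T] is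
   an ordinal type 'I_n this is the increasing order, so [st] is the
   order-preserving relabeling of [r] restricted to [A]. *)
Definition st : porder 'I_#|A| := Porder st_subproof.

End Standardization.

Section Listing.
Variable T : finType.
Implicit Types (r : rel T) (A : {set T}) (w : seq T) (alpha : seq nat).

Definition is_listing A w : bool := uniq w && ([set x in w] == A).

(* [pairwise] ranges over the positions i < j of [w]. *)
Definition linear_extension r A w : bool :=
  is_listing A w && pairwise (fun x y => ~~ r y x) w.

(* [reshape alpha w] cuts [w] into consecutive segments of lengths [alpha]. *)
Definition compatible r alpha w : bool :=
  all (fun s => linear_extension r [set x in s] s) (reshape alpha w).

Definition Sigma n r alpha : {set n.-tuple T} :=
  [set w : n.-tuple T | is_listing [set: T] w & compatible r alpha w].

Definition num_linear_extensions r : nat :=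
  #|[set w : #|T|.-tuple T | linear_extension r [set: T] w]|.

End Listing.

Definition std_poset := {n : nat & porder 'I_n}.

Section Linear.
Variables (k : fieldType) (B : choiceType) (V : lmodType k) (f : B -> V).

Definition linear_extend (h : {malg k[B]}) : V :=
  \sum_(b <- msupp h) h@_b *: f b.

End Linear.

Section Psi.
Variable k : fieldType.

Definition posets := {malg k[std_poset]}.

(* Tensor powers of a free module are free on tuples of basis elements. *)
Definition posets_tensor (m : nat) := {malg k[m.-tuple std_poset]}.

Definition coproduct : posets -> posets_tensor 2 :=
  linear_extend (fun p : std_poset =>
    \sum_(S : {set 'I_(tag p)})
      << [tuple Tagged _ (st (tagged p) S);
                Tagged _ (st (tagged p) (~: S))] >>).

Definition counit : posets -> k^o :=
  linear_extend (fun p : std_poset => (tag p == 0)%:R : k^o).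

Definition zeta : posets -> k^o :=
  linear_extend
    (fun p : std_poset => (num_linear_extensions (tagged p))%:R : k^o).

(* iter_coproduct m is the m-fold coproduct into the (m+1)-st tensor power,
   iterated on the last tensor factor. *)
Fixpoint iter_coproduct (m : nat) : posets -> posets_tensor m.+1 :=
  if m is m'.+1 then fun h =>
    linear_extend (fun pq : 2.-tuple std_poset =>
      linear_extend (fun t : m'.+1.-tuple std_poset =>
          << [tuple of tnth pq ord0 :: t] >> : posets_tensor m'.+2)
        (iter_coproduct m' << tnth pq ord_max >>))
      (coproduct h)
  else linear_extend (fun p => << [tuple p] >>).

Definition proj_degrees m (alpha : seq nat) :
    posets_tensor m -> posets_tensor m :=
  linear_extend (fun t : m.-tuple std_poset =>
    if [seq tag p | p <- t] == alpha then << t >> else 0).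

Definition zeta_tensor m : posets_tensor m -> k^o :=
  linear_extend (fun t : m.-tuple std_poset => \prod_(p <- t) zeta << p >>).

(* The empty composition corresponds to the (-1)-fold coproduct, which is the
   counit. *)
Definition zeta_comp (alpha : seq nat) (h : posets) : k :=
  if alpha is _ :: s then
    zeta_tensor (proj_degrees alpha (iter_coproduct (size s) h))
  else counit h.

(* Coefficient functions of formal power series in the variables indexed by
   nat; codomain k^o gives the pointwise k-module structure. *)
Definition power_series := {cmonom nat} -> k^o.

Definition variables_power (i alpha : seq nat) : {cmonom nat} :=
  \big[mmul/mone]_(ia <- zip i alpha) expcmn (ucm ia.1) ia.2.

(* Coefficientwise sum over increasing index sequences; for positive parts, at
   most one sequence contributes to the coefficient of a given monomial. *)
Definition monomial_qsym (alpha : seq nat) : power_series := fun m =>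
  \sum_(i \in [set i : seq nat | sorted ltn i /\ size i = size alpha]%classic)
    ((variables_power i alpha == m)%:R : k).

Definition Psi : posets -> power_series :=
  linear_extend (fun p : std_poset =>
    \sum_(alpha : composition (tag p))
      zeta_comp alpha << p >> *: monomial_qsym alpha).

Definition linear_function d (P : finPOrderType d) : power_series :=
  Psi << Tagged _ (st (order_porder P) P) >>.

End Psi.

(* Main.v *)
Require Import Defs.
From HB Require Import structures.
From mathcomp Require Import all_boot all_order all_algebra.
From mathcomp Require Import finmap monalg.
From mathcomp Require Import boolp classical_sets functions fsbigop.

Set Implicit Arguments.
Unset Strict Implicit.
Unset Printing Implicit Defensive.

Import Order.TTheory GRing.Theory.
Local Open Scope ring_scope.

(* Splitting a listing of P after its first a entries is a choice of a subset S
   of size a together with a listing of S and one of its complement, and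
   (a, alpha) is compatible with the listing iff the first part is a linear
   extension of S and alpha is compatible with the second part. This is the
   recursion that the iterated coproduct imposes on zeta_alpha(P), so by
   induction on the number of parts zeta_alpha(P) = |Sigma_P(alpha)|. *)

(** * Counting compatible listings by their first segment *)

Section CompatibleListings.
Variable T : finType.
Implicit Types (r : rel T) (A : {pred T}) (alpha : seq nat).

(** Listings are plain sequences, not tuples, so that those of [S] and of [~: S] share one type and
    can be concatenated. *)
Definition num_compatible r A alpha : nat :=
  count (compatible r alpha) (permutations (enum A)).

Lemma is_listing_perm_eq (A : {set T}) (w : seq T) :
  is_listing A w = perm_eq w (enum A).
Proof.
apply/andP/idP => [[w_uniq /eqP wA]|w_perm].
  apply: uniq_perm w_uniq (enum_uniq _) _ => x.
  by rewrite mem_enum -wA inE.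
rewrite (perm_uniq w_perm) enum_uniq; split=> //.
by apply/eqP/setP => x; rewrite inE (perm_mem w_perm) mem_enum.
Qed.

Lemma card_listings (A : {set T}) n (p : pred (seq T)) : #|A| = n ->
  #|[set w : n.-tuple T | is_listing A w && p w]|
    = count p (permutations (enum A)).
Proof.
move=> cardA; rewrite cardE -size_filter -(size_map val); apply: perm_size.
apply: uniq_perm => [||w].
- by rewrite map_inj_uniq ?enum_uniq //; apply: val_inj.
- by rewrite filter_uniq ?permutations_uniq.
rewrite mem_filter mem_permutations -is_listing_perm_eq.
apply/mapP/andP => [[t]|[pw lw]].
  by rewrite mem_enum inE => /andP[? ?] ->.
have size_w : size w == n.
  by move: lw; rewrite is_listing_perm_eq => /perm_size ->; rewrite -cardE cardA.
by exists (Tuple size_w) => //; rewrite mem_enum inE lw.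
Qed.

Lemma card_Sigma r alpha n : #|T| = n ->
  #|Sigma n r alpha| = num_compatible r [set: T] alpha.
Proof. by move=> cardT; rewrite card_listings // cardsT. Qed.

(** One segment of length [#|T|] is the whole listing; this lets [zeta] enter the recursion as a
    one-part count. *)
Lemma num_linear_extensionsE r :
  num_linear_extensions r = num_compatible r [set: T] [:: #|T|].
Proof.
rewrite -(@card_Sigma _ _ #|T|) //; apply: eq_card => w.
rewrite !inE /linear_extension /compatible /= take_oversize ?size_tuple // andbT.
rewrite /linear_extension /is_listing eqxx andbT.
by case: (uniq w) => //=; rewrite andbT.
Qed.

(** Cutting after [#|S|] entries inverts concatenation: once the prefix fills [S], the rest lists
    the complement. *)
Lemma filter_permutations_prefix (S : {set T}) :
  perm_eq
    [seq w <- permutations (enum [set: T]) | [set x in take #|S| w] == S]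
    [seq u ++ v | u <- permutations (enum S), v <- permutations (enum (~: S))].
Proof.
apply: uniq_perm => [||w].
- by rewrite filter_uniq ?permutations_uniq.
- apply: allpairs_uniq; rewrite ?permutations_uniq //.
  move=> [u v] [u' v'] /allpairsP[[x y] /= [xP _ [-> _]]].
  move=> /allpairsP[[x' y'] /= [xP' _ [-> _]]] /eqP.
  rewrite !mem_permutations in xP xP'.
  by rewrite eqseq_cat ?(perm_size xP) ?(perm_size xP') // => /andP[/eqP-> /eqP->].
rewrite mem_filter mem_permutations -is_listing_perm_eq.
apply/andP/allpairsP => [[/eqP wS /andP[w_uniq /eqP wT]]|[[u v] /= [uP vP ->]]].
  exists (take #|S| w, drop #|S| w) => /=; rewrite !mem_permutations cat_take_drop.
  move: w_uniq; rewrite -{1}(cat_take_drop #|S| w) cat_uniq => /and3P[ut dis ud].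
  rewrite -!is_listing_perm_eq /is_listing ut ud wS eqxx; split=> //=.
  apply/eqP/setP => x; rewrite !inE -[in x \in S]wS inE.
  have := finset.in_setT x; rewrite -wT inE -{1}(cat_take_drop #|S| w) mem_cat.
  have [xt|//] := boolP (x \in take _ _) => _; apply/negP => xd.
  by case/hasP: dis; exists x.
rewrite !mem_permutations in uP vP.
have size_u : size u = #|S| by rewrite (perm_size uP) cardE.
rewrite -size_u take_size_cat //.
move: uP vP; rewrite -!is_listing_perm_eq => /andP[uu /eqP uS] /andP[uv /eqP vS].
split; first exact/eqP.
rewrite /is_listing cat_uniq uu uv andbT /=; apply/andP; split.
  apply/hasPn => x xv; have: x \in ~: S by rewrite -vS inE.
  by rewrite -uS !inE.
apply/eqP/setP => x; rewrite !inE mem_cat.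
by have := finset.in_setT x; rewrite -(finset.setUCr S) inE -{1}uS -vS !inE => ->.
Qed.

Lemma compatible_cat r a alpha u v : size u = a ->
  compatible r (a :: alpha) (u ++ v)
    = compatible r [:: a] u && compatible r alpha v.
Proof.
move=> <-; rewrite /compatible /= take_size_cat // drop_size_cat //.
by rewrite take_size andbT.
Qed.

(* [S] is the set of the first [a] elements of the listing. *)
Lemma num_compatible_cons r a alpha : (a <= #|T|)%N ->
  num_compatible r [set: T] (a :: alpha)
    = (\sum_(S : {set T} | #|S| == a)
         num_compatible r S [:: a] * num_compatible r (~: S) alpha)%N.
Proof.
move=> leaT; rewrite /num_compatible -sum1_count big_seq_cond.
(* Group the listings by the set of their first [a] entries; [leaT] ensures that this set has
   exactly [a] elements. *)
rewrite (partition_big (fun w => [set x in take a w]) (fun S => #|S| == a)); last first.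
  move=> w /andP[]; rewrite mem_permutations => wP _.
  have := perm_uniq wP; rewrite enum_uniq => w_uniq.
  rewrite cardsE (card_uniqP (take_uniq _ w_uniq)) size_takel //.
  by rewrite (perm_size wP) -cardE cardsT.
apply: eq_bigr => S /eqP cardS.
under eq_bigl => w do rewrite -andbA.
rewrite -big_seq_cond sum1_count.
rewrite -[LHS](count_filter _ (fun w => [set x in take a w] == S)).
have := filter_permutations_prefix S; rewrite cardS => /permP->.
rewrite -sum1_count big_mkcond big_allpairs_dep.
rewrite -[in RHS]sum1_count big_distrl [RHS]big_mkcond /= !big_seq.
apply: eq_bigr => u; rewrite mem_permutations => uP.
have size_u : size u = a by rewrite (perm_size uP) -cardE.
under eq_bigr => v _ do rewrite compatible_cat //.
case: ifP => _; last by rewrite big1.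
by rewrite mul1n -big_mkcond sum1_count.
Qed.

End CompatibleListings.

(** * Invariance under relabeling *)

Lemma eq_num_compatible (T : finType) (r : rel T) (A B : {pred T}) alpha :
  A =i B -> num_compatible r A alpha = num_compatible r B alpha.
Proof. by move=> eqAB; rewrite /num_compatible (eq_enum eqAB). Qed.

Lemma compatible_map (T U : finType) (f : U -> T) (r : rel T) (r' : rel U) alpha w :
  injective f -> (forall x y, r' x y = r (f x) (f y)) ->
  compatible r alpha (map f w) = compatible r' alpha w.
Proof.
move=> f_inj rf; rewrite /compatible -map_reshape all_map.
apply: eq_all => s; rewrite /= /linear_extension /is_listing !eqxx !andbT.
rewrite map_inj_uniq // pairwise_map; congr andb.
by apply: eq_pairwise => x y /=; rewrite rf.
Qed.

(** [enum_val] is an isomorphism from the standardization onto [r] restricted to [A]. Counts on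
    standardized pieces thus become counts on subsets of one fixed poset. *)
Lemma num_compatible_st (T : finType) (r : porder T) (A : {pred T}) alpha :
  num_compatible (st r A) [set: 'I_#|A|] alpha = num_compatible r A alpha.
Proof.
have st_val (x y : 'I_#|A|) : st r A x y = r (enum_val x) (enum_val y).
  by rewrite {1}/porder_rel inE.
rewrite /num_compatible (eq_enum (finset.in_set predT)).
rewrite -(eq_count (fun w => compatible_map alpha w (@enum_val_inj _ _) st_val)).
rewrite -[LHS]count_map; apply/permP/uniq_perm => [||w].
- rewrite map_inj_uniq ?permutations_uniq //.
  exact/inj_map/enum_val_inj.
- exact: permutations_uniq.
have codomA : perm_eq (map enum_val (enum 'I_#|A|)) (enum A).
  apply: uniq_perm; rewrite ?(map_inj_uniq (@enum_val_inj _ A)) ?enum_uniq //.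
  move=> x; rewrite mem_enum; apply/mapP/idP => [[i _ ->]|xA].
    exact: enum_valP.
  by exists (enum_rank_in xA x); rewrite ?mem_enum ?enum_rankK_in.
rewrite mem_permutations; apply/mapP/idP => [[u]|wA].
  by rewrite mem_permutations => uP ->; rewrite -(permPr codomA) perm_map.
(* Each entry of [w] has a preimage under [enum_val], so [w] lifts entry by entry. *)
have w_val : {in w, forall x, exists i : 'I_#|A|, x = enum_val i}.
  move=> x; rewrite (perm_mem wA) mem_enum => xA.
  by exists (enum_rank_in xA x); rewrite enum_rankK_in.
have [u wu] : exists u : seq 'I_#|A|, w = map enum_val u.
  elim: w w_val {wA} => [|x w IHw] w_val; first by exists [::].
  have [i ->] := w_val x (mem_head _ _).
  case: IHw => [y yw|u ->]; first by apply: w_val; rewrite inE yw orbT.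
  by exists (i :: u).
exists u => //; rewrite mem_permutations.
by apply: (perm_map_inj (@enum_val_inj _ A)); rewrite -wu (permPr codomA).
Qed.

(** * Linear extension from a basis *)

Section LinearExtend.
Variables (k : fieldType) (B : choiceType).

(** Enlarging the index set past the support only adds zero terms; linearity follows by summing over
    one set that contains all three supports. *)
Lemma linear_extendEw (V : lmodType k) (f : B -> V) (h : {malg k[B]})
    (D : {fset B}) :
  (msupp h `<=` D)%fset -> linear_extend f h = \sum_(b <- D) h@_b *: f b.
Proof.
move=> hD; rewrite /linear_extend (big_fset_incl _ hD) // => b _ bh.
by rewrite (mcoeff_outdom bh) scale0r.
Qed.

Lemma linear_extend_is_linear (V : lmodType k) (f : B -> V) :
  linear (linear_extend f).
Proof.
move=> c g h; pose D := (msupp (c *: g + h) `|` (msupp g `|` msupp h))%fset.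
rewrite !(@linear_extendEw _ _ _ D); first last.
- exact: fsubsetUl.
- by rewrite fsubsetU // fsubsetUl orbT.
- by rewrite fsubsetU // fsubsetUr orbT.
rewrite scaler_sumr -big_split; apply: eq_bigr => b _ /=.
by rewrite mcoeffD mcoeffZ scalerDl scalerA.
Qed.

HB.instance Definition _ (V : lmodType k) (f : B -> V) :=
  GRing.isLinear.Build k {malg k[B]} V _ (linear_extend f)
    (linear_extend_is_linear f).

Lemma linear_extendU (V : lmodType k) (f : B -> V) b :
  linear_extend f << b >> = f b.
Proof.
rewrite (@linear_extendEw _ _ _ [fset b]%fset) ?msuppU_le //.
by rewrite big_seq_fset1 mcoeffU eqxx scale1r.
Qed.

Lemma linear_linear_extend (V W : lmodType k) (g : {linear V -> W})
    (f : B -> V) h :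
  g (linear_extend f h) = linear_extend (g \o f) h.
Proof. by rewrite linear_sum; apply: eq_bigr => b _; rewrite linearZ. Qed.

Lemma eq_linear_extend (V : lmodType k) (f g : B -> V) h :
  f =1 g -> linear_extend f h = linear_extend g h.
Proof. by move=> fg; apply: eq_bigr => b _; rewrite fg. Qed.

End LinearExtend.

(** * The same recursion for [zeta_comp] *)

Section ZetaComp.
Variable k : fieldType.

(* In this section [@zeta k] and [@zeta_comp k] are explicit because the
   expected type [k^o] would let inference take the regular field [k^o] as
   base field. *)
Definition zeta_degrees m (alpha : seq nat) (t : m.-tuple std_poset) : k^o :=
  if [seq tag p | p <- t] == alpha then \prod_(p <- t) @zeta k << p >> else 0.

Lemma zeta_tensor_proj m alpha (h : posets_tensor k m) :
  zeta_tensor (proj_degrees alpha h) = linear_extend (zeta_degrees alpha) h.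
Proof.
rewrite /zeta_tensor /proj_degrees linear_linear_extend.
apply: eq_linear_extend => t /=; rewrite /zeta_degrees.
by case: ifP => _; rewrite ?linear_extendU ?linear0.
Qed.

Lemma zetaU (p : std_poset) :
  @zeta k << p >> = (num_linear_extensions (tagged p))%:R.
Proof. by rewrite /zeta linear_extendU. Qed.

Lemma zeta_comp_cons a s (h : posets k) :
  zeta_comp (a :: s) h
    = linear_extend (zeta_degrees (a :: s)) (iter_coproduct (size s) h).
Proof. exact: zeta_tensor_proj. Qed.

Lemma zeta_comp1U a (p : std_poset) :
  @zeta_comp k [:: a] << p >> = if tag p == a then @zeta k << p >> else 0.
Proof.
rewrite zeta_comp_cons /= !linear_extendU /zeta_degrees /=.
by rewrite eqseq_cons andbT big_seq1.
Qed.

(** [iter_coproduct] keeps splitting the last factor, so the first coproduct fixes the first factor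
    and the rest is the iterated coproduct of the complement. *)
Lemma zeta_comp_consU a b s (p : std_poset) :
  @zeta_comp k [:: a, b & s] << p >>
    = \sum_(S : {set 'I_(tag p)})
        @zeta_comp k [:: a] << Tagged _ (st (tagged p) S) >> *
        @zeta_comp k (b :: s) << Tagged _ (st (tagged p) (~: S)) >>.
Proof.
rewrite zeta_comp_cons [iter_coproduct _ _]/= /coproduct linear_extendU.
rewrite [LHS]linear_linear_extend [LHS]linear_sum; apply: eq_bigr => S _.
rewrite [LHS]linear_extendU [LHS]linear_linear_extend zeta_comp1U.
rewrite [zeta_comp (b :: s) _]zeta_comp_cons.
rewrite !(tnth_nth (Tagged _ (st (tagged p) S))) ![nth _ _ _]/=.
rewrite /linear_extend mulr_sumr; apply: eq_bigr => t _ /=.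
rewrite linear_extendU /zeta_degrees /= eqseq_cons big_cons.
(* A degree mismatch in the first factor or in the others makes both sides zero. *)
case: (_ == a); case: (_ == b :: s) => /=.
- exact: mulrCA.
- by rewrite scaler0 mulr0.
- by rewrite scaler0 mul0r.
- by rewrite scaler0 mul0r.
Qed.

(** Both sides obey the same recursion over the first block [S]. When the degrees disagree,
    [zeta_comp] vanishes but the count need not, hence the hypothesis on [sumn alpha]. *)
Lemma zeta_compU alpha (p : std_poset) : sumn alpha = tag p ->
  @zeta_comp k alpha << p >>
    = (num_compatible (tagged p) [set: 'I_(tag p)] alpha)%:R.
Proof.
case: alpha => [|a s] sum_alpha.
  (* In degree 0 the counit is 1 and the empty list is the only listing. *)
  rewrite /zeta_comp /counit linear_extendU -[X in X == _]sum_alpha.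
  rewrite /num_compatible; suff -> : enum [set: 'I_(tag p)] = [::] by [].
  by apply: size0nil; rewrite -cardE cardsT card_ord.
elim: s a p sum_alpha => [|b s IHs] a p sum_alpha.
  rewrite zeta_comp1U ifT; last by rewrite -sum_alpha /= addn0.
  by rewrite zetaU num_linear_extensionsE card_ord -[X in [:: X]]sum_alpha /= addn0.
rewrite zeta_comp_consU num_compatible_cons; last first.
  by rewrite card_ord -sum_alpha leq_addr.
rewrite natr_sum [RHS]big_mkcond; apply: eq_bigr => S _.
(* The degree test cuts the sum down to the subsets of size [a]. *)
rewrite zeta_comp1U [tag _]/=; case: eqP => [cardS|_]; last by rewrite mul0r.
rewrite zetaU num_linear_extensionsE card_ord IHs; last first.
  apply: (@addnI a) => /=; rewrite [LHS]sum_alpha -cardS.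
  by rewrite cardsC card_ord.
by rewrite !num_compatible_st natrM /= cardS.
Qed.

End ZetaComp.

(** * Expansion of the linear function *)

Theorem theorem4p7 (k : fieldType) (k_char0 : [pchar k] =i pred0)
    (d : Order.disp_t) (P : finPOrderType d) (n : nat) (cardP : #|P| = n) :
  linear_function k P
    = \sum_(alpha : composition n)
        \sum_(w in Sigma n (<=%O : rel P) alpha)
          monomial_qsym k alpha
  /\
  \sum_(alpha : composition n)
    \sum_(w in Sigma n (<=%O : rel P) alpha)
      monomial_qsym k alpha
    = \sum_(alpha : composition n)
        #|Sigma n (<=%O : rel P) alpha|%:R
          *: monomial_qsym k alpha.
Proof.
have sum_Sigma : \sum_(alpha : composition n)
    \sum_(w in Sigma n (<=%O : rel P) alpha) monomial_qsym k alpha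
    = \sum_(alpha : composition n)
        #|Sigma n (<=%O : rel P) alpha|%:R *: monomial_qsym k alpha.
  by apply: eq_bigr => alpha _; rewrite sumr_const scaler_nat.
(* With [#|P|] in place of [n], the compositions of [n] are those of the degree of the standardized
   poset. *)
split=> //; rewrite sum_Sigma; case: n / cardP {sum_Sigma}.
rewrite /linear_function /Psi linear_extendU; apply: eq_bigr => alpha _.
have /andP[_ /eqP sum_alpha] := valP alpha.
rewrite zeta_compU // num_compatible_st card_Sigma //; congr (_%:R *: _).
rewrite (@eq_num_compatible _ _ [set: P] P) => [|x]; last by rewrite !inE.
(* [compatible_map] at the identity exchanges the stored graph of the order for [<=%O]. *)
apply: eq_count => w; rewrite -[in RHS](map_id w); apply/esym.
by apply: compatible_map => // x y; rewrite /porder_rel inE.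
Qed.
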